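(* Let $g,h:\mathbb{R}^n\to\mathbb{R}\cup\{\infty\}$ be convex functions and consider the problem $$\min\,[g(x)-h(x)]\quad\text{subject to}\quad x\in\operatorname{dom} g. \qquad (\mathrm{P})$$ Assume that: (i) (P) has an optimal solution; (ii) $g$ is polyhedral convex; (iii) $\operatorname{epi} g$ has a vertex; (iv) a representation $A$ of $g$ is given. Then the following algorithm, with input the representation $A$ of $g$ and the function $h$, works correctly, i.e. its steps can be carried out and its output $x^j$ is an optimal solution of (P): Step (1): Compute the vertices $(x^1,r^1),\dots,(x^k,r^k)$ of the polyhedron $\operatorname{epi} g$ (which is given by $A$ as a projection of a polyhedron onto $\mathbb{R}^{n+1}$). Step (2): Choose $j\in\{1,\dots,k\}$ such that $r^j-h(x^j)=\min_{i=1,\dots,k}[r^i-h(x^i)]$, and output $x^j$.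
   Context: For $f:\mathbb{R}^n\to\mathbb{R}\cup\{\infty\}$, $\operatorname{dom} f=\{x\in\mathbb{R}^n\mid f(x)\ne\infty\}$ and $\operatorname{epi} f=\{(x,r)\in\mathbb{R}^n\times\mathbb{R}\mid r\ge f(x)\}$. The function $f$ is polyhedral convex if $\operatorname{epi} f$ is a polyhedron, i.e. the solution set of finitely many linear inequalities. A matrix $A\in\mathbb{R}^{m\times(n+1+k'+1)}$, partitioned as $A=(B,b,C,c)$ with $B\in\mathbb{R}^{m\times n}$, $b\in\mathbb{R}^m$, $C\in\mathbb{R}^{m\times k'}$, $c\in\mathbb{R}^m$, is a representation of a polyhedral convex function $f$ if $$\operatorname{epi} f=\{(x,r)\in\mathbb{R}^{n+1}\mid \exists u\in\mathbb{R}^{k'}:\ Bx+br+Cu\ge c\}.$$ Vertices are extreme points. Computing the vertices of $\operatorname{epi} g$ from $A$ is a polyhedral projection problem and is treated as an available subroutine. An optimal solution of (P) is by definition a point $\bar x\in\operatorname{dom} g\cap\operatorname{dom} h$ such that $g(\bar x)-h(\bar x)\le g(x)-h(x)$ for all $x\in\operatorname{dom} g$ (where $g(x)-h(x)=-\infty$ if $h(x)=\infty$). *)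

(* Defs.v *)
From HB Require Import structures.
From mathcomp Require Import all_boot all_order all_algebra.
From mathcomp Require Import all_classical all_reals.
Set Implicit Arguments.
Unset Strict Implicit.
Unset Printing Implicit Defensive.
Import Order.TTheory GRing.Theory Num.Theory.
Local Open Scope classical_set_scope.
Local Open Scope ring_scope.

(* A function R^n -> R U {oo} is a function
   'cV[R]_n -> \bar R that satisfies [noninfty_neg]. *)

Section PolyhedralDC.
Variable R : realType.

Definition noninfty_neg n (f : 'cV[R]_n -> \bar R) : Prop :=
  forall x, f x != -oo%E.

Definition dom n (f : 'cV[R]_n -> \bar R) : set 'cV[R]_n :=
  [set x | f x != +oo%E].

(* The inequality is only required for t in the open interval ]0, 1[: the cases
   t = 0 and t = 1 are trivial, and no product 0 * oo has to be interpreted. *)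
Definition convex_fun n (f : 'cV[R]_n -> \bar R) : Prop :=
  forall (x y : 'cV[R]_n) (t : R), 0 < t < 1 ->
    (f (t *: x + (1 - t) *: y)%R <= t%:E * f x + (1 - t)%:E * f y)%E.

(* A point (x, r) of R^n x R is encoded as the column [z = col_mx x r%:M] of
   R^(n+1), with x = base z and r = height z. *)
Definition base n (z : 'cV[R]_(n + 1)) : 'cV[R]_n := usubmx z.
Definition height n (z : 'cV[R]_(n + 1)) : R := dsubmx z 0 0.

Definition epi n (f : 'cV[R]_n -> \bar R) : set 'cV[R]_(n + 1) :=
  [set z | (f (base z) <= (height z)%:E)%E].

Definition lev m (u v : 'cV[R]_m) : Prop := forall i, u i 0 <= v i 0.

Definition polyhedron N (S : set 'cV[R]_N) : Prop :=
  exists (m : nat) (M : 'M[R]_(m, N)) (d : 'cV[R]_m),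
    S = [set z | lev d (M *m z)].

Definition polyhedral_convex n (f : 'cV[R]_n -> \bar R) : Prop :=
  polyhedron (epi f).

Definition vertices N (S : set 'cV[R]_N) : set 'cV[R]_N :=
  [set z | S z /\ forall (x y : 'cV[R]_N) (t : R), S x -> S y -> 0 < t < 1 ->
             z = t *: x + (1 - t) *: y -> x = z /\ y = z].

(* The blocks of A = (B, b, C, c). *)
Definition blockB m n k (A : 'M[R]_(m, n + 1 + k + 1)) : 'M[R]_(m, n) :=
  lsubmx (lsubmx (lsubmx A)).
Definition blockb m n k (A : 'M[R]_(m, n + 1 + k + 1)) : 'cV[R]_m :=
  rsubmx (lsubmx (lsubmx A)).
Definition blockC m n k (A : 'M[R]_(m, n + 1 + k + 1)) : 'M[R]_(m, k) :=
  rsubmx (lsubmx A).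
Definition blockc m n k (A : 'M[R]_(m, n + 1 + k + 1)) : 'cV[R]_m :=
  rsubmx A.

(* {(x, r) | exists u, B x + b r + C u >= c} *)
Definition projected_polyhedron m n k (A : 'M[R]_(m, n + 1 + k + 1)) :
    set 'cV[R]_(n + 1) :=
  [set z | exists u : 'cV[R]_k,
     lev (blockc A)
         (blockB A *m base z + height z *: blockb A + blockC A *m u)].

Definition representation m n k (A : 'M[R]_(m, n + 1 + k + 1))
    (f : 'cV[R]_n -> \bar R) : Prop :=
  epi f = projected_polyhedron A.

(* In \bar R a real minus +oo is -oo, so g x - h x = -oo on dom g outside of
   dom h. *)
Definition optimal_solution n (g h : 'cV[R]_n -> \bar R) (xbar : 'cV[R]_n) :
    Prop :=
  (dom g `&` dom h) xbar /\
  forall x, dom g x -> (g xbar - h xbar <= g x - h x)%E.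

(* The two steps of the algorithm, as input/output relations: they only see the
   matrix A and the function h.  Step 1 returns a repetition-free list
   v_0, ..., v_(k-1) of the vertices of the polyhedron given by A. *)
Definition step1 m n k' (A : 'M[R]_(m, n + 1 + k' + 1))
    k (v : 'I_k -> 'cV[R]_(n + 1)) : Prop :=
  injective v /\ range v = vertices (projected_polyhedron A).

(* +oo is the neutral element of the minimum, hence the iterated minimum below
   is the minimum of the k values as soon as 0 < k; and 'I_k is empty if
   k = 0. *)
Definition step2 n (h : 'cV[R]_n -> \bar R)
    k (v : 'I_k -> 'cV[R]_(n + 1)) (j : 'I_k) : Prop :=
  ((height (v j))%:E - h (base (v j)) =
   \big[mine/+oo]_(i < k) ((height (v i))%:E - h (base (v i))))%E.

End PolyhedralDC.

(* Main.v *)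
Require Import Defs.
From mathcomp Require Import all_boot all_order all_algebra.
From mathcomp Require Import all_classical all_reals.
From mathcomp Require Import ring lra.

(** The objective of (P) extends to the function [gap h], mapping (x, r) to
    r - h x, on the polyhedron P = epi g.  Above a given x it is smallest at
    r = g x, so minimizing g - h on dom g amounts to minimizing [gap h] on P,
    and as h is convex, [gap h] is concave on P.

    A concave function that attains its minimum on a polyhedron with a vertex
    attains it at a vertex ([concave_min_at_vertex]).  Indeed, write
    P = {z | M z >= d} and let z be a minimizer that is not a vertex.  Some
    direction w <> 0 then annihilates all constraints that are active at z, so
    that z lies strictly between two points of P on the line through z in
    direction w.  By concavity the minimum is also attained at these two
    points.  Since P has a vertex, it contains no line: one can move along w or
    - w until a further constraint becomes active ([feasible_step]).  This
    increases the number of active constraints, hence the process stops, and it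
    can only stop at a vertex.

    Vertices are finite in number because each one is determined by its set of
    active constraints ([active_inj_vertices]), so the first step can be carried
    out.  The existence of an optimal solution enters twice: it provides the
    minimizer from which the process starts, and it forces h to be finite on
    dom g ([dom_h]), for otherwise the objective would take the value -oo.
    Hence the smallest gap over the list of vertices is the optimal value of
    (P), and any vertex (x, r) with that gap has x optimal, as
    g x - h x <= r - h x ([optimal_of_gap_min]). *)

Set Implicit Arguments.
Unset Strict Implicit.
Unset Printing Implicit Defensive.
Import Order.TTheory GRing.Theory Num.Theory.
Local Open Scope classical_set_scope.
Local Open Scope ring_scope.

(** * Vertices of a polyhedron and concave minimization *)

Lemma finite_set_enum (T : choiceType) (S : set T) : finite_set S ->
  exists k (v : 'I_k -> T), injective v /\ range v = S.
Proof.
move=> /finite_seqP[s ->].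
exists (size (undup s)), (tnth (in_tuple (undup s))); split.
  by apply/tuple_uniqP; exact: undup_uniq.
apply/seteqP; split=> x /=.
  by move=> [i _ <-]; rewrite -mem_undup; exact: mem_tnth.
by rewrite -mem_undup => /(tnthP (in_tuple _))[i ->]; exists i.
Qed.

(** The real c is an extreme point of the ray [c, +oo[.  This serves both for the
    values of an active constraint and for the values of a concave function
    around a minimizer. *)
Lemma convex_comb_eq_lb (R : realFieldType) (a b c t : R) : 0 < t < 1 ->
  c <= a -> c <= b -> t * a + (1 - t) * b <= c -> a = c /\ b = c.
Proof.
move=> /andP[t0 t1] ca cb abc.
have t'0 : 0 < 1 - t by rewrite subr_gt0.
have ta : 0 <= t * (a - c) by rewrite mulr_ge0 ?subr_ge0 // ltW.
have tb : 0 <= (1 - t) * (b - c) by rewrite mulr_ge0 ?subr_ge0 // ltW.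
split; apply/eqP; rewrite -subr_eq0.
  by rewrite -(mulrI_eq0 _ (lregP (lt0r_neq0 t0))); apply/eqP; lra.
by rewrite -(mulrI_eq0 _ (lregP (lt0r_neq0 t'0))); apply/eqP; lra.
Qed.

Section Polyhedron.
Variables (R : realType) (m N : nat) (M : 'M[R]_(m, N)) (d : 'cV[R]_m).
Implicit Types (x y z w : 'cV[R]_N) (i : 'I_m).

Let P : set 'cV[R]_N := [set z | lev d (M *m z)].

Definition active z : {set 'I_m} := [set i | (M *m z) i 0 == d i 0]%SET.

Lemma activeP z i : reflect ((M *m z) i 0 = d i 0) (i \in active z).
Proof. by rewrite inE; exact: eqP. Qed.

Lemma mulmx_line z s w i :
  (M *m (z + s *: w)) i 0 = (M *m z) i 0 + s * (M *m w) i 0.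
Proof. by rewrite mulmxDr -scalemxAr !mxE. Qed.

Lemma mulmx_comb x y (s t : R) i :
  (M *m (s *: x + t *: y)) i 0 = s * (M *m x) i 0 + t * (M *m y) i 0.
Proof. by rewrite mulmxDr -!scalemxAr !mxE. Qed.

Lemma mulmx_opp w i : (M *m - w) i 0 = - (M *m w) i 0.
Proof. by rewrite mulmxN mxE. Qed.

Lemma active_kernel_opp z w :
    {in active z, forall i, (M *m w) i 0 = 0} ->
  {in active z, forall i, (M *m - w) i 0 = 0}.
Proof. by move=> w0 i /w0; rewrite mulmx_opp => ->; rewrite oppr0. Qed.

(** The ratio test of the simplex method.  The active constraints do not change
    along w, and the inactive ones have slack, so some positive step is
    feasible.  If some constraint decreases along w, the longest feasible step
    makes one more constraint active. *)
Lemma feasible_step z w : P z ->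
    {in active z, forall i, (M *m w) i 0 = 0} ->
  exists2 s, 0 < s & P (z + s *: w) /\
    ((exists i, (M *m w) i 0 < 0) -> active z \proper active (z + s *: w)).
Proof.
move=> Pz w0.
have keep s : active z \subset active (z + s *: w).
  apply/fintype.subsetP => i zi; apply/activeP.
  by rewrite mulmx_line w0 // mulr0 addr0; exact/activeP.
have [i0 i0neg|nonneg] := pickP (fun i => (M *m w) i 0 < 0); last first.
  exists 1 => //; split=> [i|[i]]; last by rewrite nonneg.
  rewrite mulmx_line; have := Pz i; have := nonneg i; lra.
pose ratio i := ((M *m z) i 0 - d i 0) / - (M *m w) i 0.
case: (@arg_minP _ _ _ i0 (fun i => (M *m w) i 0 < 0) ratio i0neg).
move=> i ineg imin.
have slack_gt0 : 0 < (M *m z) i 0 - d i 0.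
  rewrite lt_def subr_ge0 Pz andbT subr_eq0; apply/negP => /eqP/activeP/w0 i0E.
  by move: ineg; rewrite i0E ltxx.
have s_gt0 : 0 < ratio i by rewrite divr_gt0 ?oppr_gt0.
(* Constraints that decrease along w allow at least the minimal ratio; the
   others never become violated. *)
exists (ratio i) => //; split=> [j|_].
  rewrite mulmx_line; have [jneg|jpos] := ltP ((M *m w) j 0) 0.
    have := imin _ jneg; rewrite {2}/ratio ler_pdivlMr ?oppr_gt0 //; lra.
  by have := Pz j; have := mulr_ge0 (ltW s_gt0) jpos; lra.
apply/properP; split; first exact: keep.
exists i; last first.
  by apply/negP => /activeP zi; move: slack_gt0; rewrite zi subrr ltxx.
apply/activeP; rewrite mulmx_line /ratio; field.
by rewrite lt_eqF.
Qed.

Lemma opposite_steps_comb z w (s s' : R) : 0 < s -> 0 < s' ->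
  let t := s' / (s + s') in
  0 < t < 1 /\ z = t *: (z + s *: w) + (1 - t) *: (z + s' *: - w).
Proof.
move=> s0 s'0 t.
have ss'0 : 0 < s + s' by exact: addr_gt0.
split.
  by rewrite divr_gt0 //= ltr_pdivrMr // mul1r ltrDr.
apply/colP => i; rewrite !mxE /t; field; exact: lt0r_neq0.
Qed.

(** The algebraic form of extremality: if a nonzero w annihilates the active
    constraints, then z is strictly between two feasible points; conversely, a
    constraint active at a point strictly between x and y in P is active at x
    and y too, so it is annihilated by x - y. *)
Lemma vertexP z : vertices P z <->
  P z /\ forall w, {in active z, forall i, (M *m w) i 0 = 0} -> w = 0.
Proof.
split=> [[Pz ext]|[Pz act0]]; split=> //.
  move=> w w0.
  have [s s0 [Px _]] := feasible_step Pz w0.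
  have [s' s'0 [Py _]] := feasible_step Pz (active_kernel_opp w0).
  have [t01 zE] := opposite_steps_comb z w s0 s'0.
  have [/eqP + _] := ext _ _ _ Px Py t01 zE.
  by rewrite -subr_eq0 addrC addKr scaler_eq0 gt_eqF //= => /eqP.
move=> x y t Px Py t01 zE.
have /act0/eqP : {in active z, forall i, (M *m (x - y)) i 0 = 0}.
  move=> i /activeP zi; rewrite mulmxBr.
  suff [xi yi] : (M *m x) i 0 = d i 0 /\ (M *m y) i 0 = d i 0.
    by rewrite mxE xi mxE yi subrr.
  apply: (convex_comb_eq_lb t01 (Px i) (Py i)).
  by rewrite -zi zE mulmx_comb.
by rewrite subr_eq0 => /eqP xy; rewrite zE xy -scalerDl addrC subrK scale1r.
Qed.

Lemma active_inj_vertices : {in vertices P &, injective active}.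
Proof.
move=> z z'; rewrite !inE => /vertexP[_ act0] _ zz'.
apply/esym/eqP; rewrite -subr_eq0; apply/eqP/act0 => i zi.
have z'i : i \in active z' by rewrite -zz'.
by rewrite mulmxBr mxE (activeP _ _ z'i) mxE (activeP _ _ zi) subrr.
Qed.

Lemma finite_vertices : finite_set (vertices P).
Proof.
rewrite -(eq_finite_set (inj_card_eq active_inj_vertices)).
exact: finite_finset.
Qed.

(** The Bauer minimum principle for a possibly unbounded polyhedron.  The
    hypothesis that a vertex exists excludes lines in P; it cannot be dropped,
    as a constant function on a half-plane shows. *)
Lemma concave_min_at_vertex (phi : 'cV[R]_N -> R) zbar :
    (exists v, vertices P v) ->
    (forall x y t, P x -> P y -> 0 < t < 1 ->
       t * phi x + (1 - t) * phi y <= phi (t *: x + (1 - t) *: y)) ->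
    P zbar -> (forall z, P z -> phi zbar <= phi z) ->
  exists2 v, vertices P v & phi v = phi zbar.
Proof.
move=> [v0 /vertexP[Pv0 v0act]] conc.
have [k] := ubnP (m - #|active zbar|)%N.
elim: k zbar => // k IHk z kz Pz zmin.
have [vz|nvz] := pselect (vertices P z); first by exists z.
have [w w0 wneq0] : exists2 w : 'cV[R]_N,
    {in active z, forall i, (M *m w) i 0 = 0} & w <> 0.
  apply: contrapT => noesc; apply/nvz/vertexP; split=> // w w0.
  by apply: contrapT => wneq0; apply: noesc; exists w.
(* Up to the sign of w some constraint decreases along w: otherwise M w = 0, and
   then w = 0 by extremality of v0. *)
wlog [i wi] : w w0 wneq0 / exists i, (M *m w) i 0 < 0.
  move=> descend.
  have [i] : exists i, (M *m w) i 0 <> 0.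
    apply: contrapT => Mw0; apply/wneq0/v0act => i _.
    by apply: contrapT => ?; apply: Mw0; exists i.
  move=> /eqP; rewrite neq_lt => /orP[wi|wi].
    by apply: (descend w) => //; exists i.
  apply: (descend (- w)).
  - exact: active_kernel_opp.
  - by move=> /eqP; rewrite oppr_eq0 => /eqP.
  - by exists i; rewrite mulmx_opp oppr_lt0.
have [s s0 [Px /(_ (ex_intro _ i wi)) zx]] := feasible_step Pz w0.
have [s' s'0 [Py _]] := feasible_step Pz (active_kernel_opp w0).
have [t01 zE] := opposite_steps_comb z w s0 s'0.
(* z is strictly between two points where phi is at least phi z, hence by
   concavity phi equals phi z at both. *)
have phix : phi (z + s *: w) = phi z.
  have := conc _ _ _ Px Py t01; rewrite -zE.
  by move=> /(convex_comb_eq_lb t01 (zmin _ Px) (zmin _ Py))[].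
rewrite -phix; apply: IHk => //; last by rewrite phix.
rewrite -ltnS; apply: leq_trans kz; rewrite ltnS.
apply: ltn_sub2l (proper_card zx).
apply: leq_trans (proper_card zx) _.
by rewrite -[leqRHS]card_ord max_card.
Qed.

End Polyhedron.

(** * The objective lifted to the epigraph *)

Section DCProgram.
Variables (R : realType) (n : nat) (g h : 'cV[R]_n -> \bar R).
Hypotheses (g_gtNy : noninfty_neg g) (h_gtNy : noninfty_neg h).

(** On the epigraph of g the value h (base z) is finite as soon as (P) has an
    optimal solution, see [gapE]; hence the default value of [fine] is never
    used there. *)
Definition gap (z : 'cV[R]_(n + 1)) : R := height z - fine (h (base z)).

Lemma dom_fin f x : noninfty_neg f -> @dom R n f x -> f x \is a fin_num.
Proof. by move=> fN fx; rewrite fin_numE fN. Qed.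

Lemma dom_base_epi z : epi g z -> dom g (base z).
Proof.
by move=> gz; rewrite /dom /= -ltey; apply: (le_lt_trans gz); exact: ltry.
Qed.

Variable xbar : 'cV[R]_n.
Hypothesis opt : optimal_solution g h xbar.

(** If h were infinite at a point of dom g, the objective would be -oo there,
    below the finite optimal value. *)
Lemma dom_h x : dom g x -> dom h x.
Proof.
move=> gx; have [[gxbar hxbar] xbar_min] := opt.
apply/eqP => hx; have := xbar_min _ gx.
rewrite hx -(fineK (dom_fin g_gtNy gx)) -(fineK (dom_fin g_gtNy gxbar)).
by rewrite -(fineK (dom_fin h_gtNy hxbar)).
Qed.

Lemma gapE z : epi g z -> ((height z)%:E - h (base z))%E = (gap z)%:E.
Proof.
move=> gz; have hz := dom_fin h_gtNy (dom_h (dom_base_epi gz)).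
by rewrite -(fineK hz) EFinB.
Qed.

Lemma gap_concave x y (t : R) : convex_fun h ->
    epi g x -> epi g y -> 0 < t < 1 -> epi g (t *: x + (1 - t) *: y) ->
  t * gap x + (1 - t) * gap y <= gap (t *: x + (1 - t) *: y).
Proof.
move=> h_convex gx gy t01 gxy; rewrite /gap.
have fin z : epi g z -> h (base z) = (fine (h (base z)))%:E.
  by move=> gz; rewrite fineK // dom_fin //; exact/dom_h/dom_base_epi.
have baseE : base (t *: x + (1 - t) *: y) = t *: base x + (1 - t) *: base y.
  by rewrite /base linearD !linearZ.
have := h_convex (base x) (base y) t t01.
rewrite -baseE (fin _ gx) (fin _ gy) (fin _ gxy) -!EFinM -EFinD lee_fin.
by rewrite /height !mxE; lra.
Qed.

Definition graph_point : 'cV[R]_(n + 1) := col_mx xbar (fine (g xbar))%:M.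

Lemma epi_graph_point : epi g graph_point.
Proof.
rewrite /epi /= /base /height /graph_point col_mxKu col_mxKd mxE eqxx mulr1n.
by rewrite fineK //; apply: dom_fin => //; case: opt => [[]].
Qed.

Lemma gap_graph_point : (gap graph_point)%:E = (g xbar - h xbar)%E.
Proof.
rewrite -gapE; last exact: epi_graph_point.
rewrite /base /height /graph_point col_mxKu col_mxKd mxE eqxx mulr1n.
by rewrite fineK //; apply: dom_fin => //; case: opt => [[]].
Qed.

Lemma objective_le_gap z : epi g z -> (g (base z) - h (base z) <= (gap z)%:E)%E.
Proof. by move=> gz; rewrite -gapE // leeB. Qed.

Lemma gap_min z : epi g z -> gap graph_point <= gap z.
Proof.
move=> gz; rewrite -lee_fin gap_graph_point.
apply: le_trans (objective_le_gap gz); apply: opt.2; exact: dom_base_epi.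
Qed.

(** The inequality g (base z) <= height z bounds the objective at base z by the
    gap of z, which is the optimal value; so base z is optimal even if z is
    merely known to lie on or above the graph of g. *)
Lemma optimal_of_gap_min z :
  epi g z -> gap z = gap graph_point -> optimal_solution g h (base z).
Proof.
move=> gz zmin; have gbz := dom_base_epi gz.
split=> [|x gx]; first by split=> //; exact: dom_h.
apply: le_trans (objective_le_gap gz) _.
by rewrite zmin gap_graph_point; exact: opt.2.
Qed.

End DCProgram.

(** * The vertex enumeration algorithm *)

Theorem corollary14 (R : realType) (n : nat) (g h : 'cV[R]_n -> \bar R)
    (m k' : nat) (A : 'M[R]_(m, n + 1 + k' + 1))
    (g_gtNy : noninfty_neg g) (h_gtNy : noninfty_neg h)
    (g_convex : convex_fun g) (h_convex : convex_fun h)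
    (has_optimal : exists xbar : 'cV[R]_n, optimal_solution g h xbar)
    (g_polyhedral : polyhedral_convex g)
    (has_vertex : exists z : 'cV[R]_(n + 1), vertices (epi g) z)
    (A_represents_g : representation A g) :
  (exists (k : nat) (v : 'I_k -> 'cV[R]_(n + 1)), step1 A v) /\
  (forall (k : nat) (v : 'I_k -> 'cV[R]_(n + 1)), step1 A v ->
     (exists j : 'I_k, step2 h v j) /\
     (forall j : 'I_k, step2 h v j -> optimal_solution g h (base (v j)))).
Proof.
have [p [M [d epiE]]] := g_polyhedral.
have [xbar opt] := has_optimal.
rewrite /step1 -A_represents_g; split.
  by apply: finite_set_enum; rewrite epiE; exact: finite_vertices.
have [v0 v0_vertex v0_min] : exists2 z, vertices (epi g) z &
    gap h z = gap h (graph_point g xbar).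
  have conc x y t : epi g x -> epi g y -> 0 < t < 1 ->
      t * gap h x + (1 - t) * gap h y <= gap h (t *: x + (1 - t) *: y).
    move=> gx gy t01; apply: (gap_concave g_gtNy h_gtNy opt) => //.
    move: gx gy; rewrite epiE => gx gy i.
    rewrite mulmx_comb; have := gx i; have := gy i; nra.
  have gbar := epi_graph_point g_gtNy opt.
  have zmin := gap_min g_gtNy h_gtNy opt.
  move: has_vertex conc gbar zmin; rewrite epiE.
  exact: concave_min_at_vertex.
move=> k v [_ vE].
have epi_v i : epi g (v i).
  by have [] : vertices (epi g) (v i) by rewrite -vE; exists i.
have [j0 _ vj0] : range v v0 by rewrite vE.
(* The smallest gap over the listed vertices is the optimal value of (P). *)
pose gbar := (gap h (graph_point g xbar))%:E.
have minE : (\big[mine/+oo]_(i < k)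
    ((height (v i))%:E - h (base (v i))) = gbar)%E.
  apply/le_anti/andP; split.
    apply: (le_trans (bigmin_le _ j0 _)).
    by rewrite (gapE g_gtNy h_gtNy opt) // vj0 v0_min.
  apply: le_bigmin => [|i _]; first exact: leey.
  by rewrite (gapE g_gtNy h_gtNy opt) // lee_fin (gap_min g_gtNy h_gtNy opt).
rewrite /step2 minE; split=> [|j].
  by exists j0; rewrite (gapE g_gtNy h_gtNy opt) // vj0 v0_min.
rewrite (gapE g_gtNy h_gtNy opt) // => -[jmin].
exact: (optimal_of_gap_min g_gtNy h_gtNy opt).
Qed.
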